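(* The twist preserves the totally positive part of the Grassmannian and the totally nonnegative part of the Grassmannian. That is, if $p\in(\mathrm{Gr}_{k,n})_{>0}$ then $\overleftarrow{p}\in(\mathrm{Gr}_{k,n})_{>0}$, and if $p\in(\mathrm{Gr}_{k,n})_{\ge0}$ is a point at which the twist is defined then $\overleftarrow{p}\in(\mathrm{Gr}_{k,n})_{\ge0}$.
   Context: Let $1\le k\le n-1$. A point of the (real or complex) Grassmannian $\mathrm{Gr}_{k,n}$ is a rank $k$ matrix $p$ of size $k\times n$, with columns $p_1,\dots,p_n$, up to left multiplication by $GL_k$. For a $k$-subset $I$ of $\{1,\dots,n\}$, $[I](p)$ is the minor of $p$ with column set $I$ in increasing order; the $[I]$ are homogeneous (Plücker) coordinates. The totally positive part $(\mathrm{Gr}_{k,n})_{>0}$ of $\mathrm{Gr}_{k,n}(\mathbb{R})$ is the set of points having a representative with $[I](p)>0$ for all $k$-subsets $I$ of $\{1,\dots,n\}$; the totally nonnegative part $(\mathrm{Gr}_{k,n})_{\ge0}$ is the set of points having a representative with $[I](p)\ge0$ for all $k$-subsets $I$ of $\{1,\dots,n\}$. Let $\sigma(i)=i-1$ reduced modulo $n$ into $\{1,\dots,n\}$. For vectors $v_1,\dots,v_{k-1}$ in $k$-space, $v_1\times\cdots\times v_{k-1}$ is the unique vector with $(v_1\times\cdots\times v_{k-1})^Tv=\det(v_1,\dots,v_{k-1},v)$ for all $v$ (it is $1$ if $k=1$). The twist $\overleftarrow{p}$ is the $k\times n$ matrix with $i$th column $\varepsilon_i\, p_{\sigma^{k-1}(i)}\times\cdots\times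 p_{\sigma(i)}$, with $\varepsilon_i=(-1)^{i(k-i)}$ if $i\le k-1$ and $\varepsilon_i=1$ if $i\ge k$. It induces a rational map from $\mathrm{Gr}_{k,n}$ to itself, defined at $p$ when the matrix $\overleftarrow{p}$ has rank $k$. *)

(* Defs.v *)
From HB Require Import structures.
From mathcomp Require Import all_boot all_order all_algebra.
From mathcomp Require Import reals.

Set Implicit Arguments.
Unset Strict Implicit.
Unset Printing Implicit Defensive.
Import Order.TTheory GRing.Theory Num.Theory.
Local Open Scope ring_scope.

(* A point of Gr_{k,n} over F is handled through its representatives: matrices
   p : 'M[F]_(k, n) of rank k, two of which are the same point when they are
   related by gr_eq. *)
Definition gr_rep (F : fieldType) (k n : nat) (p : 'M[F]_(k, n)) : Prop :=
  \rank p = k.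

Definition gr_eq (F : fieldType) (k n : nat) (p q : 'M[F]_(k, n)) : Prop :=
  exists2 g : 'M[F]_k, g \in unitmx & q = g *m p.

(* enum_val lists the elements of I : {set 'I_n} in increasing order. *)
Definition plucker (F : fieldType) (k n : nat) (p : 'M[F]_(k, n))
    (I : {set 'I_n}) (cardI : #|I| = k) : F :=
  \det (colsub (fun j : 'I_k => enum_val (cast_ord (esym cardI) j)) p).

Definition gr_totally_positive (R : realType) (k n : nat)
    (p : 'M[R]_(k, n)) : Prop :=
  gr_rep p /\
  exists2 q : 'M[R]_(k, n), gr_eq p q &
    forall (I : {set 'I_n}) (cardI : #|I| = k), 0 < plucker q cardI.

Definition gr_totally_nonnegative (R : realType) (k n : nat)
    (p : 'M[R]_(k, n)) : Prop :=
  gr_rep p /\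
  exists2 q : 'M[R]_(k, n), gr_eq p q &
    forall (I : {set 'I_n}) (cardI : #|I| = k), 0 <= plucker q cardI.

(* The k x k matrix with columns v_1, ..., v_(k-1), u, for k > 0. *)
Definition append_col (F : fieldType) (k : nat)
    (v : 'I_k.-1 -> 'cV[F]_k) (u : 'cV[F]_k) : 'M[F]_k :=
  \matrix_(a, j) (if insub (val j) is Some j' then v j' a 0 else u a 0).

(* v_1 x ... x v_(k-1); the defining property is crossP below. *)
Definition cross (F : fieldType) (k : nat) (v : 'I_k.-1 -> 'cV[F]_k) :
    'cV[F]_k :=
  \col_a \det (append_col v (delta_mx a 0)).

(* Columns are numbered from 0: i : 'I_n stands for the 1-based index i.+1.
   ord_pred is the cyclic predecessor on 'I_n, and the j-th factor of the
   product (j = 0, ..., k-2) is the column of index sigma^(k-1-j)(i). *)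
Definition twist_sign (F : fieldType) (k : nat) (i : nat) : F :=
  if (i <= k - 1)%N then (-1) ^+ (i * (k - i)) else 1.

Definition twist (F : fieldType) (k n : nat) (p : 'M[F]_(k, n)) :
    'M[F]_(k, n) :=
  \matrix_(a, i) (twist_sign F k i.+1 *
    cross (fun j : 'I_k.-1 => col (iter (k - 1 - j) (@ord_pred n) i) p) a 0).

Definition twist_defined (F : fieldType) (k n : nat) (p : 'M[F]_(k, n)) :
    Prop :=
  gr_rep (twist p).

Lemma crossE (F : fieldType) (k : nat) (v : 'I_k.-1 -> 'cV[F]_k)
    (u : 'cV[F]_k) : (0 < k)%N ->
  (cross v)^T *m u = (\det (append_col v u))%:M.
Proof.
case: k v u => // k v u _; apply/matrixP=> x y; rewrite !ord1 !mxE eqxx mulr1n.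
have nI : insub k = None :> option 'I_k by apply: insubF; rewrite ltnn.
rewrite (expand_det_col (append_col v u) ord_max); apply: eq_bigr => a _.
rewrite !mxE nI mulrC; congr (_ * _).
rewrite (expand_det_col _ ord_max) (bigD1 a) //= big1 => [|b nb].
  rewrite !mxE nI !eqxx mul1r addr0 /cofactor; congr (_ * \det _).
  apply/matrixP=> b c; rewrite !mxE /= /bump leqNgt ltn_ord add0n.
  by rewrite insubT //= => ?.
by rewrite !mxE nI (negPf nb) mul0r.
Qed.

Lemma crossP (F : fieldType) (k : nat) (v : 'I_k.-1 -> 'cV[F]_k)
    (w : 'cV[F]_k) : (0 < k)%N ->
  (forall u : 'cV[F]_k, w^T *m u = (\det (append_col v u))%:M) <->
  w = cross v.
Proof.
move=> k0; split=> [hw|-> u]; last exact: crossE.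
apply/matrixP=> i j; rewrite ord1.
have := hw (delta_mx i 0); rewrite -crossE // => /matrixP/(_ 0 0).
rewrite !mxE (bigD1 i) //= big1 => [|b nb]; last first.
  by rewrite !mxE (negPf nb) mulr0.
rewrite [in RHS](bigD1 i) //= [in RHS]big1 => [|b nb]; last first.
  by rewrite !mxE (negPf nb) mulr0.
by rewrite !mxE !eqxx !mulr1 !addr0.
Qed.

(* The twist descends to points of the Grassmannian. *)
Lemma twist_mul (F : fieldType) (k n : nat) (g : 'M[F]_k)
    (p : 'M[F]_(k, n)) : (0 < k)%N -> g \in unitmx ->
  twist (g *m p) = (\det g *: (invmx g)^T) *m twist p.
Proof.
move=> k0 gU; have cg (v : 'I_k.-1 -> 'cV[F]_k) :
    cross (fun j => g *m v j) = (\det g *: (invmx g)^T) *m cross v.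
  apply/esym/crossP => // u; rewrite trmx_mul linearZ /= trmxK -scalemxAr.
  rewrite -scalemxAl -mulmxA crossE // scale_scalar_mx -det_mulmx.
  congr (\det _)%:M; apply/matrixP=> a j; rewrite !mxE.
  transitivity ((g *m col j (append_col v (invmx g *m u))) a 0).
    by rewrite !mxE; apply: eq_bigr => b _; rewrite !mxE.
  case E: (insub (val j) : option 'I_k.-1) => [j'|].
    by rewrite !mxE; apply: eq_bigr => b _; rewrite !mxE E.
  rewrite -[in RHS](mulKVmx gU u) [in RHS]mxE !mxE.
  by apply: eq_bigr => b _; rewrite !mxE E.
apply/matrixP=> a i; rewrite [LHS]mxE.
have -> : cross (fun j : 'I_k.-1 =>
    col (iter (k - 1 - j) (@ord_pred n) i) (g *m p)) =
  cross (fun j : 'I_k.-1 => g *m col (iter (k - 1 - j) (@ord_pred n) i) p).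
  apply/matrixP=> b c; rewrite !mxE; congr (\det _).
  by apply/matrixP=> d e; rewrite !mxE; case: insub => // j; rewrite !mxE;
  apply: eq_bigr => h _; rewrite !mxE.
rewrite cg mxE [RHS]mxE mulr_sumr; apply: eq_bigr => b _.
by rewrite [twist p b i]mxE mulrCA.
Qed.

Lemma twist_gr_eq (F : fieldType) (k n : nat) (p q : 'M[F]_(k, n)) :
  (0 < k)%N -> gr_eq p q -> gr_eq (twist p) (twist q).
Proof.
move=> k0 [g gU ->]; exists (\det g *: (invmx g)^T); last exact: twist_mul.
rewrite unitmxZ; last by rewrite -unitmxE.
by rewrite unitmx_tr unitmx_inv.
Qed.

(* Main.v *)
Require Import Defs.
From mathcomp Require Import all_boot all_order all_algebra.
From mathcomp Require Import reals zify ring lra.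

(** Write [I] for the maximal minors of a k x n matrix p whose minors are all
    positive, put m = k - 1, and extend the columns to all indices by
    p_(j+n) = (-1)^m p_j.  Moving the first column of a minor to the last place
    costs exactly the sign (-1)^m, so every minor of the extended sequence whose
    columns lie in a window of length n is still positive
    (quasi_periodic_windows).  The signs in the definition of the twist are those
    produced by this extension: column i of the twist is the plain cross product
    of p_(i-m), ..., p_(i-1) in the extended sequence (twist_colE).

    Hence the pairing of a twisted column q_i with p_j is the minor on the columns
    i-m, ..., i-1, j.  It vanishes for j in [i-m, i-1] and is positive for j = i.
    Now det(q_I) [J] is the determinant of the matrix of the pairings of q_I with
    p_J.  If I is the union of two intervals, J can be chosen so that this matrix
    is block triangular, one diagonal block being triangular with positive
    diagonal; the other block occurs again in the same computation for an interval
    I, where everything is triangular.  This gives positivity of the minors of the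
    twist on unions of two intervals (dual_two_intervals_gt0).  A Fekete type
    criterion, resting on the three-term Pluecker relation, says that positivity
    on [1, a] together with one more interval is enough for positivity on all
    column sets (coldet_three_term, fekete_criterion).  This settles the totally
    positive case (twist_minors_gt0).

    For nonnegative minors, suppose that some minor of p vanishes.  Any two column
    sets are joined by moves that replace one index by a neighbour, so there are
    neighbouring column sets, one with positive and one with zero minor
    (colset_connected).  Adding t > 0 times one column to a neighbouring one then
    makes the zero minor positive and decreases no minor (shear_moved, shear_le).
    By induction on the number of zero minors the twist of the sheared matrix has
    nonnegative minors for all t > 0; these are polynomials in t, so the same
    holds at t = 0 (twist_minors_ge0). *)

Set Implicit Arguments.
Unset Strict Implicit.
Unset Printing Implicit Defensive.
Import Order.TTheory GRing.Theory Num.Theory.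
Local Open Scope ring_scope.

(** * Determinants of lists of columns *)

Definition coldet (F : comNzRingType) (k : nat) (s : seq 'cV[F]_k) : F :=
  \det (\matrix_(a < k, j < k) nth 0 s j a 0).

Section ColumnDeterminants.
Variables (F : comNzRingType) (m : nat).
Implicit Types (s w : seq 'cV[F]_m.+1) (u v : 'cV[F]_m.+1).

(** Laplace expansion along an inserted column: the cofactors only see the
    remaining list s1 ++ s2, whatever the position of u, up to the sign.  Signs of
    cyclic moves and linearity in a column both follow from this. *)
Lemma coldet_insert s1 s2 u : (size s1 <= m)%N ->
  coldet (s1 ++ u :: s2) = \sum_a u a 0 * ((-1) ^+ (a + size s1) *
    \det (\matrix_(r < m, j < m) nth 0 (s1 ++ s2) j (lift a r) 0)).
Proof.
move=> hs; rewrite /coldet.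
rewrite (expand_det_col _ (Ordinal (hs : (size s1 < m.+1)%N))).
apply: eq_bigr => a _.
rewrite !mxE nth_cat ltnn subnn /=; congr (_ * _).
rewrite /cofactor /=; congr (_ * \det _); apply/matrixP => r j.
rewrite !mxE /= !nth_cat /bump.
case: (leqP (size s1) j) => h /=.
  by rewrite add1n ltnNge leqW // subSn.
by rewrite add0n h.
Qed.

Lemma coldet_cycle s1 s2 u : (size s1 <= m)%N ->
  coldet (s1 ++ u :: s2) = (-1) ^+ size s1 * coldet (u :: s1 ++ s2).
Proof.
move=> hs; rewrite coldet_insert // -(cat0s (u :: _)) coldet_insert //= mulr_sumr.
by apply: eq_bigr => a _; rewrite addn0 exprD; ring.
Qed.

Lemma coldet_insertD s1 s2 u v (t : F) : (size s1 <= m)%N ->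
  coldet (s1 ++ (u + t *: v) :: s2) =
  coldet (s1 ++ u :: s2) + t * coldet (s1 ++ v :: s2).
Proof.
move=> hs; rewrite !coldet_insert // mulr_sumr -big_split /=.
by apply: eq_bigr => a _; rewrite !mxE; ring.
Qed.

Lemma coldet_insertZ s1 s2 u (t : F) : (size s1 <= m)%N ->
  coldet (s1 ++ t *: u :: s2) = t * coldet (s1 ++ u :: s2).
Proof.
move=> hs; rewrite !coldet_insert // mulr_sumr.
by apply: eq_bigr => a _; rewrite !mxE; ring.
Qed.

Lemma coldet_eq0 s i j : (i < j <= m)%N -> nth 0 s i = nth 0 s j ->
  coldet s = 0.
Proof.
move=> /andP [ij jm] e; rewrite /coldet -det_tr.
have im : (i < m.+1)%N by lia.
apply: (@determinant_alternate _ _ _ (Ordinal im) (Ordinal (jm : (j < m.+1)%N))).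
  by rewrite -val_eqE /=; lia.
by move=> a; rewrite !mxE /= e.
Qed.

Lemma coldet_repeat s1 s2 u : (size s1 <= m)%N -> u \in s1 ++ s2 ->
  (size (s1 ++ s2) <= m)%N -> coldet (s1 ++ u :: s2) = 0.
Proof.
move=> hs us hs2; rewrite coldet_cycle //.
rewrite (@coldet_eq0 _ 0 (index u (s1 ++ s2)).+1) ?mulr0 //=; last by rewrite nth_index.
by rewrite (leq_trans _ hs2) // index_mem.
Qed.

(** Quadratic Pluecker relation.  Put the linear form u |-> coldet (u :: w) as a
    last row below the k + 1 columns of s: it is a combination of the other rows,
    so the determinant is zero, and its expansion along that row is the sum. *)
Lemma coldet_plucker s w : size s = m.+2 ->
  \sum_(i < m.+2) (-1) ^+ i *
    coldet (take i s ++ drop i.+1 s) * coldet (nth 0 s i :: w) = 0.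
Proof.
move=> hs.
pose f (a : 'I_m.+1) : F := (-1) ^+ (nat_of_ord a) *
  \det (\matrix_(r < m, j < m) nth 0 w j (lift a r) 0).
have fE u : coldet (u :: w) = \sum_a u a 0 * f a.
  rewrite -(cat0s (u :: w)) coldet_insert //.
  by apply: eq_bigr => a _; rewrite addn0.
pose A := \matrix_(a < m.+2, j < m.+2)
  (if unlift ord_max a is Some b then nth 0 s j b 0
   else coldet (nth 0 s j :: w)).
have A0 : \det A = 0.
  (* r lists the coefficients of the vanishing combination of rows. *)
  pose r := \row_(a < m.+2) (if unlift ord_max a is Some b then - f b else 1).
  have rA : r *m A = 0.
    apply/matrixP => x j; rewrite !mxE big_ord_recr /=.
    rewrite !mxE unlift_none mul1r fE -big_split big1 //= => a _.
    have -> : widen_ord (leqnSn m.+1) a = lift ord_max a.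
      by apply: val_inj; rewrite /= /bump leqNgt ltn_ord.
    by rewrite !mxE liftK; ring.
  have := congr1 (fun M => (M *m \adj A) 0 ord_max) rA.
  rewrite -mulmxA mul_mx_adj mul0mx mul_mx_scalar !mxE unlift_none mulr1.
  by [].
rewrite (expand_det_row _ ord_max) in A0.
move: A0 => /(congr1 (fun x => (-1) ^+ m.+1 * x)); rewrite mulr0 mulr_sumr => A0.
rewrite -[RHS]A0; apply: eq_bigr => i _.
rewrite !mxE unlift_none /cofactor exprD.
set d := \det _; have -> : coldet (take i s ++ drop i.+1 s) = d.
  rewrite /coldet /d; congr (\det _); apply/matrixP => a j.
  rewrite !mxE liftK nth_cat size_take hs ltn_ord /= /bump.
  case: (leqP i j) => h /=; last by rewrite nth_take.
  by rewrite nth_drop; congr (nth 0 s _ a 0); lia.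
rewrite [RHS](_ : _ = ((-1) ^+ m.+1 * (-1) ^+ m.+1) *
   ((-1) ^+ i * d * coldet (s`_i :: w))); last by ring.
by rewrite -expr2 sqrr_sign mul1r.
Qed.
End ColumnDeterminants.

(** The relation coldet_plucker for the k + 1 columns A, l, M1, x, M2, r and for
    w = A, a, M1, M2: only l, x and r are absent from w, so three terms survive.
    The position of each column is recorded so that for increasing indices
    a < l < x < r every minor has its columns in order and no sign remains. *)
Lemma coldet_three_term (F : comNzRingType) (m : nat)
    (A M1 M2 : seq 'cV[F]_m.+1) (a l x r : 'cV[F]_m.+1) :
  (size A + size M1 + size M2).+1 = m ->
  coldet (A ++ a :: M1 ++ x :: M2) * coldet (A ++ l :: M1 ++ M2 ++ [:: r]) =
  coldet (A ++ a :: l :: M1 ++ M2) * coldet (A ++ M1 ++ x :: M2 ++ [:: r]) +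
  coldet (A ++ a :: M1 ++ M2 ++ [:: r]) * coldet (A ++ l :: M1 ++ x :: M2).
Proof.
move=> hm.
pose s := A ++ l :: M1 ++ x :: M2 ++ [:: r].
pose w := A ++ a :: M1 ++ M2.
have hs : size s = m.+2 by rewrite /s; do ?rewrite size_cat /=; lia.
have hw : size w = m by rewrite /w; do ?rewrite size_cat /=; lia.
have := coldet_plucker w hs.
have l1 : (size A < m.+2)%N by lia.
have l2 : (size A + (size M1).+1 < m.+2)%N by lia.
rewrite (bigD1 (Ordinal l1)) //= (bigD1 (Ordinal l2)) /=; last first.
  by rewrite -val_eqE /=; lia.
rewrite (bigD1 ord_max) /=; last by rewrite -!val_eqE /=; lia.
rewrite big1 => [|i]; last first.
  rewrite -!val_eqE /= !neq_ltn => hi.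
  suff iw : nth 0 s i \in w.
    have := @coldet_repeat _ _ [::] w (nth 0 s i) _ iw.
    by rewrite !cat0s hw => -> //; rewrite mulr0.
  have i2 := ltn_ord i.
  rewrite /s /w !nth_cat; case: (ltnP i (size A)) => h1.
    by rewrite mem_cat mem_nth.
  rewrite mem_cat in_cons mem_cat.
  have -> : (i - size A)%N = (i - size A).-1.+1 by lia.
  rewrite /= nth_cat; case: (ltnP _ (size M1)) => h2.
    by rewrite (mem_nth 0 h2) !orbT.
  have -> : ((i - size A).-1 - size M1)%N = ((i - size A).-1 - size M1).-1.+1 by lia.
  rewrite /= nth_cat ifT; last by lia.
  have h3 : (((i - size A).-1 - size M1).-1 < size M2)%N by lia.
  by rewrite (mem_nth 0 h3) !orbT.
have n1 : nth 0 s (size A) = l by rewrite /s nth_cat ltnn subnn.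
have n2 : nth 0 s (size A + (size M1).+1) = x.
  by rewrite /s nth_cat ltnNge leq_addr addKn /= nth_cat ltnn subnn.
have n3 : nth 0 s m.+1 = r.
  have -> : s = rcons (A ++ l :: M1 ++ x :: M2) r.
    by rewrite /s -cats1 -!catA /= -catA.
  by rewrite nth_rcons ifF ?ifT //; do ?rewrite size_cat /=; lia.
have d1 : take (size A) s ++ drop (size A).+1 s = A ++ M1 ++ x :: M2 ++ [:: r].
  by rewrite /s take_size_cat // -cat1s catA drop_size_cat // size_cat addn1.
have d2 : take (size A + (size M1).+1) s ++ drop (size A + (size M1).+1).+1 s
    = A ++ l :: M1 ++ M2 ++ [:: r].
  have -> : s = (A ++ l :: M1) ++ [:: x] ++ M2 ++ [:: r].
    by rewrite /s -!catA.
  rewrite take_size_cat ?size_cat //.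
  by rewrite catA drop_size_cat -?catA // !size_cat /=; lia.
have d3 : take m.+1 s ++ drop m.+2 s = A ++ l :: M1 ++ x :: M2.
  have -> : s = (A ++ l :: M1 ++ x :: M2) ++ [:: r].
    by rewrite /s -!catA /= -!catA.
  rewrite take_size_cat; last by do ?rewrite size_cat /=; lia.
  by rewrite drop_oversize ?cats0 //; do ?rewrite size_cat /=; lia.
rewrite n1 n2 n3 d1 d2 d3 addr0.
have c1 : coldet (l :: w) = (-1) ^+ (size A).+1 * coldet (A ++ a :: l :: M1 ++ M2).
  have -> : A ++ a :: l :: M1 ++ M2 = (A ++ [:: a]) ++ l :: M1 ++ M2 by rewrite -catA.
  rewrite coldet_cycle; last by rewrite size_cat /=; lia.
  rewrite -catA size_cat addn1 mulrA -expr2 sqrr_sign mul1r; by [].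
have c2 : coldet (x :: w) = (-1) ^+ (size A + (size M1).+1) * coldet (A ++ a :: M1 ++ x :: M2).
  have -> : A ++ a :: M1 ++ x :: M2 = (A ++ a :: M1) ++ x :: M2 by rewrite -catA.
  rewrite coldet_cycle; last by rewrite size_cat /=; lia.
  by rewrite -catA size_cat mulrA -expr2 sqrr_sign mul1r.
have c3 : coldet (r :: w) = (-1) ^+ m * coldet (A ++ a :: M1 ++ M2 ++ [:: r]).
  have -> : A ++ a :: M1 ++ M2 ++ [:: r] = w ++ [:: r] by rewrite /w -!catA /= -!catA.
  by rewrite coldet_cycle hw // cats0 mulrA -expr2 sqrr_sign mul1r.
rewrite c1 c2 c3.
set p1 := coldet (A ++ M1 ++ _); set p2 := coldet (A ++ a :: l :: _).
set p3 := coldet (A ++ l :: M1 ++ M2 ++ _); set p4 := coldet (A ++ a :: M1 ++ x :: _).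
set p5 := coldet (A ++ l :: _); set p6 := coldet (A ++ a :: _).
have sq k : ((-1) ^+ k : F) * (-1) ^+ k = 1 by rewrite -expr2 sqrr_sign.
rewrite !exprS => h; apply: subr0_eq; rewrite -[RHS]h.
move: (sq (size A)) (sq (size A + (size M1).+1)%N) (sq m).
set e1 := _ ^+ size A; set e2 := _ ^+ (size A + _); set e3 := _ ^+ m.
move=> h1 h2 h3.
transitivity (- (e1 * e1) * p1 * p2 + (e2 * e2) * p3 * p4 - (e3 * e3) * p5 * p6).
  by rewrite h1 h2 h3; ring.
by ring.
Qed.

Section Gram.
Variables (F : comNzRingType).

Lemma coldet_gram k (s t : seq 'cV[F]_k) :
  coldet s * coldet t =
  \det (\matrix_(i < k, j < k) ((nth 0 s i)^T *m nth 0 t j) 0 0).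
Proof.
rewrite /coldet -det_tr -det_mulmx; congr (\det _); apply/matrixP => i j.
by rewrite !mxE; apply: eq_bigr => a _; rewrite !mxE.
Qed.

Lemma det_lower_blocks a c (M : nat -> nat -> F) :
  (forall i j, (i < a)%N -> (j < c)%N -> M i (a + j)%N = 0) ->
  \det (\matrix_(i < a + c, j < a + c) M i j) =
  \det (\matrix_(i < a, j < a) M i j) *
  \det (\matrix_(i < c, j < c) M (a + i)%N (a + j)%N).
Proof.
move=> M0; set A := (X in \det X = _).
have uA : @ursubmx _ a c a c A = 0.
  by apply/matrixP => i j; rewrite !mxE /= M0.
rewrite -(submxK A : @block_mx _ a c a c _ _ _ _ = A) uA det_lblock.
by congr (_ * _); congr (\det _); apply/matrixP => i j; rewrite !mxE.
Qed.

Lemma det_lower_triangular c (M : nat -> nat -> F) :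
  (forall i j, (i < j < c)%N -> M i j = 0) ->
  \det (\matrix_(i < c, j < c) M i j) = \prod_(i < c) M i i.
Proof.
move=> M0; rewrite det_trig; first by apply: eq_bigr => i _; rewrite mxE.
by apply/is_trig_mxP => i j ij; rewrite mxE M0 // ij /=.
Qed.

Lemma det_scale_cols k (A : 'M[F]_k) (d : 'I_k -> F) :
  \det (\matrix_(i, j) (A i j * d j)) = \det A * \prod_j d j.
Proof.
rewrite -[RHS](_ : \det (A *m diag_mx (\row_j d j)) = _).
  by congr (\det _); apply/matrixP => i j; rewrite mul_mx_diag !mxE.
by rewrite det_mulmx det_diag; congr (_ * _); apply: eq_bigr => j _; rewrite mxE.
Qed.

End Gram.

(** * A Fekete criterion for positivity of all maximal minors *)

Lemma sorted_ltn_cat s1 s2 : sorted ltn (s1 ++ s2) =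
  [&& allrel ltn s1 s2, sorted ltn s1 & sorted ltn s2].
Proof. by rewrite !(sorted_pairwise ltn_trans) pairwise_cat. Qed.

Lemma sorted_ltn_cons x s :
  sorted ltn (x :: s) = all (ltn x) s && sorted ltn s.
Proof. by rewrite -cat1s sorted_ltn_cat allrel1l. Qed.

Lemma sorted_ltn_rcons s x :
  sorted ltn (rcons s x) = all (fun y => y < x)%N s && sorted ltn s.
Proof. by rewrite -cats1 sorted_ltn_cat allrel1r /= andbT. Qed.

Lemma sorted_ltn_ext s1 s2 : sorted ltn s1 -> sorted ltn s2 -> s1 =i s2 -> s1 = s2.
Proof. exact: (irr_sorted_eq ltn_trans ltnn). Qed.

Lemma sorted_gap_split s x : sorted ltn s -> x \notin s ->
  exists s1 s2, [/\ s = s1 ++ s2, all (fun y => y < x)%N s1 & all (ltn x) s2].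
Proof.
move=> ss xs; exists [seq y <- s | (y < x)%N], [seq y <- s | (x < y)%N].
split; try exact: filter_all.
apply: sorted_ltn_ext => //.
  rewrite sorted_ltn_cat !sorted_filter ?andbT //; try exact: ltn_trans.
  by apply/allrelP => y z; rewrite !mem_filter => /andP [+ _] /andP [+ _] /=; lia.
move=> y; rewrite mem_cat !mem_filter -andb_orl.
case ys: (y \in s); rewrite ?andbF // andbT.
by case: ltngtP => // e; move: xs; rewrite -e ys.
Qed.

Lemma sorted_ltn_insert s1 s2 x : sorted ltn (s1 ++ s2) ->
  all (fun y => y < x)%N s1 -> all (ltn x) s2 -> sorted ltn (s1 ++ x :: s2).
Proof.
rewrite !sorted_ltn_cat sorted_ltn_cons => /and3P [h12 h1 h2] h1x hx2.
by rewrite h1 h2 hx2 allrel_consr h12 h1x.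
Qed.

Lemma sorted_ltn_iota_cat a s :
  sorted ltn (iota 0 a ++ s) = all (leq a) s && sorted ltn s.
Proof.
rewrite sorted_ltn_cat iota_ltn_sorted /=; congr (_ && _); apply/allrelP/allP => h.
  move=> x xs /=; case: (leqP a x) => // xa.
  by have := h x x; rewrite mem_iota add0n xa xs => /(_ isT isT) /=; rewrite ltnn.
by move=> y x; rewrite mem_iota => /andP [_ ya] xs; have := h x xs; rewrite /=; lia.
Qed.

(** Outer induction on the number c of indices outside the initial interval
    [0, a): a column set that contains a is handled by the case c - 1.  Inner
    induction on the length of an interval containing the other indices L.  If
    these are l < ... < r with a gap x, the three-term relation for a, l, x, r
    expresses the minor through minors that contain a, and two minors in which
    x replaces l or r, so that the remaining indices lie in a shorter interval. *)
Lemma fekete_criterion (R : realDomainType) (m n : nat)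
    (V : nat -> 'cV[R]_m.+1) : (m < n)%N ->
  (forall a b c, (a + c)%N = m.+1 -> (a <= b)%N -> (b + c <= n)%N ->
     0 < coldet [seq V i | i <- iota 0 a ++ iota b c]) ->
  forall s, sorted ltn s -> size s = m.+1 -> all (fun y => y < n)%N s ->
  0 < coldet [seq V i | i <- s].
Proof.
move=> mn H.
suff P c : forall a L, (a + c)%N = m.+1 -> size L = c ->
   sorted ltn (iota 0 a ++ L) -> all (fun y => y < n)%N L ->
   0 < coldet [seq V i | i <- iota 0 a ++ L].
  by move=> s s1 s2 s3; apply: (P m.+1 0%N).
elim: c => [|c IHc] a L hac sL.
  case: L sL => // _ _ _; apply: (H a a 0%N) => //; lia.
pose hull lo d := all (fun x => lo <= x < lo + d)%N.
suff Q d : forall lo L, hull lo d L -> size L = c.+1 ->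
    sorted ltn (iota 0 a ++ L) -> all (fun y => y < n)%N L ->
    0 < coldet [seq V i | i <- iota 0 a ++ L].
  by move=> s1 s2; exact: (Q n 0%N).
elim: d {L sL} => [|d IHd] lo L hL sL.
  by case: L hL sL => //= x L; case: ltnP => //; lia.
case: L hL sL => // l L hlL [sL] sorL ltL.
have [aL sorL'] : all (leq a) (l :: L) /\ sorted ltn (l :: L).
  by apply/andP; rewrite -sorted_ltn_iota_cat.
have [la|la] := eqVneq l a.
  have e : iota 0 a ++ l :: L = iota 0 a.+1 ++ L.
    by rewrite -addn1 iotaD -catA add0n la.
  rewrite e; apply: IHc; rewrite -?e //; first by lia.
  by case/andP: ltL.
have {la} al : (a < l)%N by rewrite ltn_neqAle eq_sym la; case/andP: aL.
case/lastP: L sL sorL ltL sorL' hlL aL => [|L r] sL sorL ltL sorL' hlL aL.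
  have c0 : c = 0%N by case: (c) sL.
  rewrite c0 in hac *; apply: (H a l 1%N) => //; first by lia.
  by rewrite addn1; case/andP: ltL.
have [/allP Lall|/allPn [x]] := boolP (all (mem L) (iota l.+1 (r - l.+1))).
  have lr : (l < r)%N.
    by move: sorL'; rewrite sorted_ltn_cons all_rcons => /andP [/andP []].
  have e : l :: rcons L r = iota l (r - l).+1.
    apply: sorted_ltn_ext => //; first exact: iota_ltn_sorted.
    move=> y; apply/idP/idP => yL.
      have : (l <= y <= r)%N.
        move: sorL'; rewrite -rcons_cons sorted_ltn_rcons => /andP [h1].
        rewrite sorted_ltn_cons => /andP [h2 _].
        move: yL; rewrite -rcons_cons mem_rcons !in_cons.
        case: eqP => [->|_ /=]; first by lia.
        case: eqP => [->|_ /= yL]; first by lia.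
        have := allP h1 y; have := allP h2 y yL; rewrite in_cons yL orbT /= => ? /(_ isT); lia.
      by rewrite mem_iota; lia.
    rewrite in_cons mem_rcons in_cons; move: yL; rewrite mem_iota.
    case: eqP => //= yl; case: eqP => //= yr ?; apply: Lall; rewrite mem_iota; lia.
  have rlc : (r - l)%N = c.
    by move: sL; have := congr1 size e; rewrite /= size_iota; lia.
  rewrite {}rlc in e.
  rewrite e; apply: H => //; first by lia.
  have := ltL; rewrite e => /allP /(_ (l + c)%N); rewrite mem_iota /=; lia.
rewrite mem_iota => xlr xL.
have sorM : sorted ltn L.
  by move: sorL'; rewrite -rcons_cons sorted_ltn_rcons sorted_ltn_cons => /and3P [].
have [M1 [M2 [eL xM1 xM2]]] := sorted_gap_split sorM xL.
(* The column sets in the three-term relation: the flags tell which of a, l, x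
   and r are present. *)
pose sel (ba bl bx br : bool) := iota 0 a ++ nseq ba a ++ nseq bl l ++ M1 ++
  nseq bx x ++ M2 ++ nseq br r.
pose D ba bl bx br := coldet [seq V i | i <- sel ba bl bx br].
have [lx xr] : (l < x)%N /\ (x < r)%N by clear -xlr; lia.
have sM : (size M1 + size M2).+1 = c by move: sL; rewrite eL size_rcons size_cat.
have all_sel : sorted ltn (sel true true true true).
  rewrite /sel -[iota 0 a ++ _]/(iota 0 a ++ [:: a] ++ _) catA.
  rewrite -[_ ++ [:: a]]/(iota 0 a ++ iota (0 + a) 1) -iotaD addn1.
  have sorT : sorted ltn (l :: M1 ++ x :: M2 ++ [:: r]).
    apply: (@sorted_ltn_insert (l :: M1)) => /=; last 1 first.
    - by rewrite all_cat xM2 /= andbT.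
    - by rewrite /= catA -eL cats1.
    - by rewrite lx.
  rewrite sorted_ltn_iota_cat sorT andbT /= al.
  by move: sorT; rewrite sorted_ltn_cons => /andP [/sub_all + _]; apply=> y /=; exact: ltn_trans.
have sorted_sel ba bl bx br : sorted ltn (sel ba bl bx br).
  apply: (subseq_sorted ltn_trans _ all_sel).
  by rewrite /sel; case: ba; case: bl; case: bx; case: br;
    do ?[apply: cat_subseq]; rewrite ?sub0seq ?subseq_refl.
have three_term : D true false true false * D false true false true =
    D true true false false * D false false true true +
    D true false false true * D false true true false.
  have := @coldet_three_term R m [seq V i | i <- iota 0 a] [seq V i | i <- M1]
    [seq V i | i <- M2] (V a) (V l) (V x) (V r).
  rewrite /D /sel /= !map_cat /= !map_cat /= !map_cat /= !cats0; apply.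
  by rewrite !size_map size_iota; clear -sM hac; lia.
have all_tail (P : pred nat) (bl bx br : bool) : P l || ~~ bl -> P x || ~~ bx -> P r || ~~ br ->
  all P L -> all P (nseq bl l ++ M1 ++ nseq bx x ++ M2 ++ nseq br r).
  by rewrite eL !all_cat !all_nseq => + + + /andP [-> ->];
    case: (P l); case: (P x); case: (P r); case: bl; case: bx; case: br.
have ltn_tail (bl bx br : bool) : all (fun y => y < n)%N (nseq bl l ++ M1 ++
  nseq bx x ++ M2 ++ nseq br r).
  move: ltL => /=; rewrite all_rcons => /and3P [ln rn Ln].
  apply: all_tail => //; rewrite ?ln ?rn //.
  by rewrite (ltn_trans xr rn).
have size_sel (bl bx br : bool) : (bl + bx + br = 2)%N -> size (nseq bl l ++ M1 ++
  nseq bx x ++ M2 ++ nseq br r) = c.+1.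
  move=> hb; rewrite !size_cat !size_nseq; move: hb sM.
  by move: (nat_of_bool bl) (nat_of_bool bx) (nat_of_bool br); clear; lia.
have with_a (bl bx br : bool) : (bl + bx + br = 1)%N -> 0 < D true bl bx br.
  move=> hb; rewrite /D; have e : sel true bl bx br = iota 0 a.+1 ++ nseq bl l ++ M1 ++
    nseq bx x ++ M2 ++ nseq br r.
    by rewrite -addn1 iotaD -catA.
  rewrite e; apply: IHc => //; first by rewrite addSnnS.
  - rewrite !size_cat !size_nseq; move: hb sM.
    by move: (nat_of_bool bl) (nat_of_bool bx) (nat_of_bool br); clear; lia.
  - by rewrite -e.
have [hl hr hL] : [/\ (lo <= l < lo + d.+1)%N, (lo <= r < lo + d.+1)%N & hull lo d.+1 L].
  by move: hlL; rewrite /hull /= all_rcons => /and3P [].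
have [lL Lr] : all (ltn l) L /\ all (fun y => y < r)%N L.
  move: sorL'; rewrite -rcons_cons sorted_ltn_rcons sorted_ltn_cons /=.
  by case/and3P=> /andP [_ ->] ->.
have sel_lt : 0 < D false true true false.
  apply: (IHd lo (nseq true l ++ M1 ++ nseq true x ++ M2 ++ nseq false r)) => //.
  - apply: all_tail; rewrite ?orbT //; try by clear -hl hr lx xr; lia.
    by apply/allP => y yL; move: (allP Lr y yL) (allP hL y yL) hr; clear; rewrite /=; lia.
  - exact: size_sel.
  - exact: (sorted_sel false true true false).
have sel_gt : 0 < D false false true true.
  apply: (IHd lo.+1 (nseq false l ++ M1 ++ nseq true x ++ M2 ++ nseq true r)) => //.
  - apply: all_tail; rewrite ?orbT //; try by clear -hl hr lx xr; lia.
    by apply/allP => y yL; move: (allP lL y yL) (allP hL y yL) hl; clear; rewrite /=; lia.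
  - exact: size_sel.
  - exact: (sorted_sel false false true true).
have -> : iota 0 a ++ l :: rcons L r = sel false true false true.
  by rewrite /sel /= -cats1 eL -catA.
rewrite -/(D false true false true) -(pmulr_rgt0 _ (with_a false true false erefl)).
by rewrite three_term addr_gt0 // mulr_gt0 // with_a.
Qed.

(** * Minors of the twist on two intervals *)

(** Here Q i is orthogonal to P i, ..., P (i + m - 1) and pairs positively with
    P (i + m). *)
Section TwoIntervals.
Variables (R : realDomainType) (m n : nat) (P Q : nat -> 'cV[R]_m.+1).
Hypothesis mn : (m < n)%N.
Hypothesis P_windows : forall s, sorted ltn s -> size s = m.+1 ->
  all (fun y => y < head 0 s + n)%N s -> 0 < coldet [seq P i | i <- s].
Hypothesis Q_dual : forall i j,
  ((Q i)^T *m P j) 0 0 = coldet [seq P h | h <- rcons (iota i m) j].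

Let gram j i := ((P j)^T *m Q i) 0 0.

Lemma gramE j i : gram j i = coldet [seq P h | h <- rcons (iota i m) j].
Proof.
rewrite -Q_dual -[in RHS](trmxK (P j)) -trmx_mul [RHS]mxE.
by [].
Qed.

Lemma gram_eq0 i j : (i <= j < i + m)%N -> gram j i = 0.
Proof.
move=> /andP [ij ji]; rewrite gramE map_rcons -cats1 coldet_repeat ?size_cat ?size_map ?size_iota //.
  by rewrite cats0 map_f // mem_iota ij.
by rewrite addn0.
Qed.

Lemma gram_gt0 i : 0 < gram (i + m) i.
Proof.
rewrite gramE -[rcons _ _](_ : iota i m.+1 = _); last by rewrite -addn1 iotaD cats1.
apply: P_windows; rewrite ?iota_ltn_sorted ?size_iota //.
by apply/allP => y; rewrite mem_iota /=; lia.
Qed.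

Lemma coldet_gram_nat (s t : seq nat) : size s = m.+1 -> size t = m.+1 ->
  coldet [seq P j | j <- s] * coldet [seq Q i | i <- t] =
  \det (\matrix_(i < m.+1, j < m.+1) gram (nth 0%N s i) (nth 0%N t j)).
Proof.
move=> hs ht; rewrite coldet_gram; congr (\det _); apply/matrixP => i j.
by rewrite !mxE /gram !(nth_map 0%N) ?hs ?ht // mxE.
Qed.

Lemma dual_interval_gt0 i : 0 < coldet [seq Q h | h <- iota i m.+1].
Proof.
have Pi : 0 < coldet [seq P h | h <- iota (i + m) m.+1].
  apply: P_windows; rewrite ?iota_ltn_sorted ?size_iota //.
  by apply/allP => y; rewrite mem_iota /=; lia.
rewrite -(pmulr_rgt0 _ Pi) coldet_gram_nat ?size_iota //.
rewrite [X in \det X](_ : _ = \matrix_(j < m.+1, h < m.+1) gram (i + m + j)%N (i + h)%N).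
  rewrite (@det_lower_triangular _ m.+1 (fun j h => gram (i + m + j)%N (i + h)%N)).
    by apply: prodr_gt0 => j _; rewrite addnAC gram_gt0.
  by move=> j h hj; apply: gram_eq0; lia.
by apply/matrixP => x y; rewrite !mxE !nth_iota.
Qed.

(** Let X be the block of pairings of Q on [s, s + a) with P on the a indices that
    precede b + m.  With the columns P on [b + m - a, b + m + c), the matrix of
    pairings has diagonal blocks X and a triangular one.  The sign of det X is
    found from the interval [s - c, s + a) for Q: with P on the c indices that
    precede s + m and the a indices that precede b + m, the diagonal blocks are
    a triangular one and X. *)
Lemma dual_two_intervals_gt0 a b c s : (a + c)%N = m.+1 -> (c <= s)%N ->
  (s + a <= b)%N -> (b + c <= s + n)%N ->
  0 < coldet [seq Q i | i <- iota s a ++ iota b c].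
Proof.
move=> ac cs sab bcs.
pose X := \det (\matrix_(j < a, i < a) gram (b + m - a + j)%N (s + i)%N).
have nth_two s1 s2 i : nth 0%N (iota s1 a ++ iota s2 c) i =
   if (i < a)%N then (s1 + i)%N else if (i - a < c)%N then (s2 + (i - a))%N else 0%N.
  rewrite nth_cat size_iota; case: ltnP => h1; first by rewrite nth_iota.
  case: ltnP => h2; first by rewrite nth_iota.
  by rewrite nth_default // size_iota.
(* m.+1 = a + c only holds propositionally, and the block decomposition needs a
   size that is syntactically a sum. *)
have castdet (M : nat -> nat -> R) a' c' : (a' + c')%N = m.+1 ->
  \det (\matrix_(i < m.+1, j < m.+1) M i j) =
  \det (\matrix_(i < a' + c', j < a' + c') M i j) by move<-.
have X_gt0 : 0 < X.
  pose J := iota (s - c + m) c ++ iota (b + m - a) a.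
  pose I := iota (s - c) m.+1.
  have sJ : size J = m.+1 by rewrite size_cat !size_iota addnC.
  have PJ : 0 < coldet [seq P j | j <- J].
    apply: P_windows => //.
      rewrite sorted_ltn_cat !iota_ltn_sorted !andbT.
      by apply/allrelP => y z; rewrite !mem_iota /=; lia.
    apply/allP => y; rewrite /J mem_cat !mem_iota.
    (* The first index of J lies in its second interval when c = 0. *)
    case: (posnP c) => [c0|cp].
      have -> : head 0%N (iota (s - c + m) c ++ iota (b + m - a) a) = (b + m - a)%N.
        by rewrite c0 /=; case: (a) ac => [|a'] //=; rewrite c0.
      by rewrite c0; lia.
    have -> : head 0%N (iota (s - c + m) c ++ iota (b + m - a) a) = (s - c + m)%N.
      by case: (c) cp.
    by lia.
  have QI := dual_interval_gt0 (s - c).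
  have := mulr_gt0 PJ QI; rewrite coldet_gram_nat ?size_iota //.
  pose M j i := gram (nth 0%N J j) (nth 0%N I i).
  have JE i : (i < c + a)%N -> nth 0%N J i =
      if (i < c)%N then (s - c + m + i)%N else (b + m - a + (i - c))%N.
    by move=> ia; rewrite nth_cat size_iota; case: ltnP => h; rewrite nth_iota //; lia.
  have IE i : (i < c + a)%N -> nth 0%N I i = (s - c + i)%N.
    by move=> ia; rewrite nth_iota //; lia.
  rewrite (castdet M c a); last by rewrite addnC.
  rewrite (@det_lower_blocks _ c a M); last first.
    by move=> i j ic ja; rewrite /M JE ?IE ?ic; try lia; apply: gram_eq0; lia.
  rewrite (@det_lower_triangular _ c M); last first.
    move=> i j ijc; rewrite /M JE ?IE; try lia.
    by rewrite ifT; try lia; apply: gram_eq0; lia.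
  rewrite pmulr_rgt0.
    congr (0 < \det _); apply/matrixP => i j; rewrite !mxE /M.
    have := ltn_ord i; have := ltn_ord j => ja ia.
    rewrite JE ?IE; try lia.
    by rewrite ifF; try lia; congr gram; lia.
  apply: prodr_gt0 => i _; have := ltn_ord i => ic.
  rewrite /M JE ?IE ?ic; try lia.
  by rewrite addnAC gram_gt0.
have PJ : 0 < coldet [seq P j | j <- iota (b + m - a) m.+1].
  apply: P_windows; rewrite ?iota_ltn_sorted ?size_iota //.
  by apply/allP => y; rewrite mem_iota /=; lia.
rewrite -(pmulr_rgt0 _ PJ) coldet_gram_nat ?size_cat ?size_iota //.
pose M j i := gram (nth 0%N (iota (b + m - a) m.+1) j) (nth 0%N (iota s a ++ iota b c) i).
have JE i : (i < a + c)%N -> nth 0%N (iota (b + m - a) m.+1) i = (b + m - a + i)%N.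
  by move=> ia; rewrite nth_iota //; lia.
rewrite (castdet M a c) // (@det_lower_blocks _ a c M); last first.
  move=> i j ia jc; rewrite /M JE ?nth_two; try lia.
  by rewrite ifF ?ifT; try lia; apply: gram_eq0; lia.
apply: mulr_gt0.
  move: X_gt0; congr (0 < \det _); apply/matrixP => i j; rewrite !mxE /M.
  have := ltn_ord i; have := ltn_ord j => ja ia.
  by rewrite JE ?nth_two ?ja //; lia.
rewrite (@det_lower_triangular _ c (fun i j => M (a + i)%N (a + j)%N)).
  apply: prodr_gt0 => i _; have := ltn_ord i => ic.
  rewrite /M JE ?nth_two; try lia.
  rewrite ifF ?ifT; try lia.
  by rewrite (_ : b + m - a + (a + i) = b + (a + i - a) + m)%N ?gram_gt0 //; lia.
move=> i j ijc; rewrite /M JE ?nth_two; try lia.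
by rewrite ifF ?ifT; try lia; apply: gram_eq0; lia.
Qed.
End TwoIntervals.

(** * Minors of matrices and Pluecker coordinates *)

(** Columns are indexed by nat, so that column sets can be lists of numbers and
    index arithmetic is free. *)
Definition nat_col (F : comNzRingType) k n (p : 'M[F]_(k, n)) (j : nat) : 'cV[F]_k :=
  if insub j is Some i then col i p else 0.

Definition colset k n (s : seq nat) :=
  [&& sorted ltn s, size s == k & all (fun y => y < n)%N s].

Definition minor (F : comNzRingType) k n (p : 'M[F]_(k, n)) (s : seq nat) : F :=
  coldet [seq nat_col p i | i <- s].

Lemma nat_colE (F : comNzRingType) k n (p : 'M[F]_(k, n)) (i : 'I_n) : nat_col p i = col i p.
Proof. by rewrite /nat_col insubT //= => h; congr (col _ p); apply: val_inj. Qed.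

Definition enum_ord n (I : {set 'I_n}) : seq nat := [seq val i | i <- enum I].

Lemma colset_enum_ord n (I : {set 'I_n}) : colset #|I| n (enum_ord I).
Proof.
apply/and3P; split.
- apply: (subseq_sorted ltn_trans _ (iota_ltn_sorted 0 n)).
  rewrite -val_enum_ord map_subseq // {1}/enum_mem -enumT.
  exact: filter_subseq.
- by rewrite size_map -cardE.
- by apply/allP => _ /mapP [i _ ->] /=.
Qed.

(** Increasing lists and subsets of 'I_n describe the same column sets. *)
Lemma colset_set k n s : colset k n s ->
  exists I : {set 'I_n}, #|I| = k /\ s = enum_ord I.
Proof.
move=> /and3P [ss /eqP sz sn].
have e : s = enum_ord [set i : 'I_n | val i \in s].
  apply: sorted_ltn_ext => //; first by case/and3P: (colset_enum_ord [set i : 'I_n | val i \in s]).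
  move=> x; apply/idP/mapP => [xs|[i]].
    by exists (Ordinal (allP sn x xs)); rewrite // mem_enum inE.
  by rewrite mem_enum inE => ? ->.
exists [set i : 'I_n | val i \in s]; split => //.
by rewrite -sz [in RHS]e size_map -cardE.
Qed.

Lemma pluckerE (F : fieldType) k n (p : 'M[F]_(k, n)) (I : {set 'I_n}) (cardI : #|I| = k) :
  plucker p cardI = minor p (enum_ord I).
Proof.
congr (\det _); apply/matrixP => a j; rewrite !mxE.
set i := enum_val _.
have hj : (j < size (enum I))%N by rewrite -cardE cardI.
rewrite -map_comp (nth_map i) //= nat_colE mxE /i; congr (fun_of_matrix p a _).
exact: enum_val_nth.
Qed.

Lemma plucker_minors (F : fieldType) k n (p : 'M[F]_(k, n)) (P : pred F) :
  (forall (I : {set 'I_n}) (cardI : #|I| = k), P (plucker p cardI)) <->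
  (forall s, colset k n s -> P (minor p s)).
Proof.
split=> H => [s /colset_set [I [cI ->]]|I cI]; first by rewrite -(pluckerE p cI).
by rewrite pluckerE H // -{1}cI colset_enum_ord.
Qed.

(** A full-rank row selection of the transpose need not be increasing; sorting the
    selected columns does not change the space they span. *)
Lemma rank_minor_neq0 (F : fieldType) k n (p : 'M[F]_(k, n)) :
  \rank p = k -> exists2 s, colset k n s & minor p s != 0.
Proof.
move=> rp.
have full : row_full p^T by rewrite /row_full mxrank_tr rp.
pose f := fullrankfun full; pose I := f @: [set: 'I_k].
have cI : #|I| = k by rewrite card_imset ?cardsT ?card_ord //; exact: fullrankfun_inj.
exists (enum_ord I); first by rewrite -{1}cI colset_enum_ord.
rewrite -(pluckerE p cI) /plucker -det_tr -unitfE -unitmxE -row_full_unit.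
pose g j := enum_val (cast_ord (esym cI) j).
have -> : (colsub g p)^T = rowsub g p^T by apply/matrixP => i j; rewrite !mxE.
have fI j : f j \in I by apply: imset_f.
pose h j := cast_ord cI (enum_rank_in (fI j) (f j)).
have := fullrowsub_unit full; rewrite -row_full_unit -!sub1mx => /submx_trans; apply.
apply: (@submx_rowsub _ _ _ _ _ h) => j.
by rewrite /= /g /h cast_ordK enum_rankK_in.
Qed.

Lemma minor_neq0_rank (F : fieldType) k n (p : 'M[F]_(k, n)) s :
  colset k n s -> minor p s != 0 -> \rank p = k.
Proof.
move=> /colset_set [I [cI ->]]; rewrite -(pluckerE p cI) /plucker -unitfE -unitmxE.
set g := (X in colsub X _) => /mxrank_unit rk.
apply/eqP; rewrite eqn_leq rank_leq_row /= -{1}rk -mxrank_tr -[X in (_ <= X)%N]mxrank_tr.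
by rewrite (_ : _^T = rowsub g p^T) ?mxrankS ?rowsub_sub //; apply/matrixP => i j; rewrite !mxE.
Qed.

(** * The twist preserves positivity of minors *)

(** The sign (-1)^m for each period makes cyclic shifts of a window of columns
    preserve determinants. *)
Definition quasi_periodic (F : comNzRingType) m n (V : nat -> 'cV[F]_m.+1) (j : nat) :
    'cV[F]_m.+1 :=
  (-1) ^+ (m * (j %/ n)) *: V (j %% n)%N.

(** While the last index x of the window is at least n, move it to the front as
    x - n: the sign of moving the column past the m others cancels the sign of
    the period.  This lowers the sum of the indices. *)
Lemma quasi_periodic_windows (R : realDomainType) m n (V : nat -> 'cV[R]_m.+1) :
  (forall s, sorted ltn s -> size s = m.+1 -> all (fun y => y < n)%N s ->
     0 < coldet [seq V i | i <- s]) ->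
  forall s, sorted ltn s -> size s = m.+1 ->
    all (fun y => y < head 0 s + n)%N s ->
    0 < coldet [seq quasi_periodic n V i | i <- s].
Proof.
move=> HV s; have [d] := ubnP (sumn s); elim: d s => // d IH s sd ss sz sw.
case/lastP: s sd ss sz sw => // s x sd ss sz sw.
have n0 : (0 < n)%N.
  rewrite lt0n; apply/eqP => e; move: sw; rewrite e addn0 headI /= ltnn //.
have [xn|nx] := ltnP x n.
  have sn : all (fun y => y < n)%N (rcons s x).
    move: ss; rewrite sorted_ltn_rcons all_rcons xn /= => /andP [+ _].
    by apply: sub_all => y /=; lia.
  have -> : [seq quasi_periodic n V i | i <- rcons s x] = [seq V i | i <- rcons s x].
    apply/eq_in_map => y /(allP sn) /= yn.
    by rewrite /quasi_periodic divn_small // modn_small // muln0 scale1r.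
  exact: HV.
have e : quasi_periodic n V x = (-1) ^+ m *: quasi_periodic n V (x - n).
  rewrite /quasi_periodic -{1 2}(subnK nx) modnDr divnDr // divnn n0 addn1.
  by rewrite mulnS exprD scalerA.
have szs : size s = m by move: sz; rewrite size_rcons => -[].
rewrite map_rcons e -cats1 coldet_insertZ ?size_map ?szs //.
rewrite coldet_cycle ?size_map ?szs // mulrA -expr2 sqrr_sign mul1r cats0.
rewrite -map_cons; apply: IH.
- by move: sd; rewrite sumn_rcons /=; lia.
- move: ss sw; rewrite sorted_ltn_rcons sorted_ltn_cons all_rcons => /andP [_ ss] /andP [xs sw].
  rewrite ss andbT; case: s {sd sz e szs} ss xs sw => //= y s.
  rewrite path_sortedE => [/andP [ys _] xy _|]; last exact: ltn_trans.
  by rewrite ltn_subLR // addnC xy /=; apply: sub_all ys => z /=; lia.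
- by rewrite /= szs.
- move: ss; rewrite sorted_ltn_rcons => /andP [sx _].
  by rewrite /= subnK // sx andbT; lia.
Qed.

Lemma iter_ord_predE n (i : 'I_n) d : (d <= n)%N ->
  val (iter d (@ord_pred n) i) = ((i + n - d) %% n)%N.
Proof.
case: n i => [|n] i; first by case: i.
elim: d => [|d IH] dn; first by rewrite subn0 modnDr modn_small.
rewrite iterS /= IH; last by lia.
have -> : ((i + n.+1 - d) %% n.+1 + n.+1).-1 = ((i + n.+1 - d) %% n.+1 + n)%N by lia.
rewrite modnDml.
have -> : (i + n.+1 - d + n)%N = (i + n.+1 - d.+1 + n.+1)%N by lia.
by rewrite modnDr.
Qed.

Lemma append_colE (F : fieldType) m (P : nat -> 'cV[F]_m.+1) x u :
  \det (@append_col F m.+1 (fun j : 'I_m => P (x + j)%N) u) =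
  coldet (rcons [seq P i | i <- iota x m] u).
Proof.
congr (\det _); apply/matrixP => a j; rewrite !mxE nth_rcons size_map size_iota.
case: insubP => [j' jm <- | jm].
  by rewrite ltn_ord (nth_map 0%N) ?size_iota ?nth_iota // ltn_ord.
have := ltn_ord j; move: jm => /=; rewrite -leqNgt => mj jm.
by rewrite ltnNge mj ifT //; lia.
Qed.

(** The column indices that wrap around are those with i + j < m.  There are m - i
    of them, each contributing (-1)^m, and m (m - i) has the parity of
    (i + 1) (m - i), the exponent in twist_sign.  The shift by two periods leaves
    the sign unchanged, and gives room for the indices below i - m that
    dual_two_intervals_gt0 uses. *)
Lemma twist_colE (F : fieldType) m n (p : 'M[F]_(m.+1, n)) (i : 'I_n) : (m < n)%N ->
  col i (twist p) =
  @cross F m.+1 (fun j : 'I_m => quasi_periodic n (nat_col p) (n.*2 + i - m + j)).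
Proof.
move=> mn; apply/matrixP => a b; rewrite !mxE.
(* The ratio between column j of the extended sequence and of p. *)
pose sg (j : 'I_m.+1) : F := if (i + j < m)%N then (-1) ^+ m else 1.
set B := append_col (fun j => col _ p) _.
rewrite [X in _ = \det X](_ : _ = \matrix_(x, j) (B x j * sg j)).
  rewrite det_scale_cols mulrC; congr (_ * _).
  rewrite big_ord_recr /= {2}/sg /= ifF ?mulr1; last by lia.
  rewrite (eq_bigr (fun j : 'I_m => if (i + j < m)%N then (-1) ^+ m else 1)) //.
  rewrite -(big_mkord xpredT (fun j => if (i + j < m)%N then (-1) ^+ m else 1)).
  rewrite (big_cat_nat (n := (m - i)%N)) ?leq_subr //=.
  rewrite [X in _ * X]big_nat_cond [X in _ * X]big1 ?mulr1; last first.
    by move=> j /andP [+ _]; case: ifP => //; lia.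
  rewrite big_nat_cond (eq_bigr (fun=> (-1) ^+ m)); last first.
    by move=> j /andP [+ _]; case: ifP => //; lia.
  rewrite -big_nat_cond prodr_const_nat subn0 -exprM /twist_sign subn1 /= subSS.
  case: ltnP => im; last by rewrite (eqP (im : (m - i)%N == 0%N)) muln0.
  (* With d = m - i > 0, the exponents (i + 1) d and (d + i) d agree mod 2. *)
  rewrite -signr_odd -[RHS]signr_odd !oddM oddS -{2}(subnK (ltnW im)) oddD.
  by case: (odd _); case: (odd _).
apply/matrixP => x j; rewrite !mxE.
have jm' := ltn_ord j; have im := ltn_ord i.
case: insubP => [j' jm jj' | jm]; last first.
  by rewrite /sg ifF ?mulr1 //; move: jm => /=; lia.
rewrite !mxE.
have -> y : p x y = nat_col p (val y) x 0 by rewrite nat_colE mxE.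
rewrite iter_ord_predE subn1 /=; last by lia.
rewrite /sg; have {jm'} jE : nat_of_ord j' = j by [].
have {}jm : (j < m)%N by [].
rewrite jE; have -> : ((n.*2 + i - m + j) %% n = (i + n - (m - j)) %% n)%N.
  rewrite (_ : n.*2 + i - m + j = i + n - (m - j) + n)%N ?modnDr //; lia.
rewrite mulrC; congr (_ * _).
case: ifP => ij.
  rewrite (_ : (n.*2 + i - m + j) %/ n = 1)%N ?muln1 //.
  rewrite (_ : n.*2 + i - m + j = 1 * n + (n + i + j - m))%N; last by lia.
  by rewrite divnMDl; [rewrite divn_small ?addn0 //; lia|lia].
rewrite (_ : (n.*2 + i - m + j) %/ n = 2)%N ?exprM ?sqrr_sign //.
rewrite (_ : n.*2 + i - m + j = 2 * n + (i + j - m))%N; last by lia.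
by rewrite divnMDl; [rewrite divn_small ?addn0 //; lia|lia].
Qed.

Lemma twist_minors_gt0 (R : realFieldType) m n (p : 'M[R]_(m.+1, n)) :
  (m < n)%N ->
  (forall s, colset m.+1 n s -> 0 < minor p s) ->
  (forall s, colset m.+1 n s -> 0 < minor (twist p) s).
Proof.
move=> mn Hp.
pose P := quasi_periodic n (nat_col p).
pose Q x := @cross R m.+1 (fun j : 'I_m => P (x + j)%N).
have twQ i : (i < n)%N -> nat_col (twist p) i = Q (n.*2 - m + i)%N.
  move=> i_n; rewrite -[i]/(val (Ordinal i_n)) nat_colE twist_colE //.
  by rewrite addnC -addnBA ?[(i + _)%N]addnC //; lia.
have P_windows : forall s, sorted ltn s -> size s = m.+1 ->
    all (fun y => y < head 0 s + n)%N s -> 0 < coldet [seq P i | i <- s].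
  by apply: quasi_periodic_windows => s ss sz sn; apply: Hp; rewrite /colset ss sz eqxx.
have Q_dual i j : ((Q i)^T *m P j) 0 0 = coldet [seq P h | h <- rcons (iota i m) j].
  by rewrite crossE // mxE eqxx mulr1n append_colE map_rcons.
move=> s /and3P [ss /eqP sz sn]; apply: fekete_criterion sn => // a b c ac ab bc.
have -> : [seq nat_col (twist p) i | i <- iota 0 a ++ iota b c] =
    [seq Q i | i <- iota (n.*2 - m) a ++ iota (n.*2 - m + b) c].
  rewrite -[in RHS](addn0 (n.*2 - m)%N) -addnA add0n !iotaDl -map_cat -map_comp.
  apply/eq_in_map => i; rewrite mem_cat !mem_iota => hi; apply: twQ; lia.
by apply: (dual_two_intervals_gt0 mn P_windows Q_dual ac); lia.
Qed.

(** * Polynomial functions of one parameter *)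

(** The matrices below have entries in a field, over which the twist is defined,
    so dependence on t is expressed by functions and not by matrices of
    polynomials. *)
Definition poly_fun (F : comNzRingType) (f : F -> F) : Prop :=
  exists P : {poly F}, forall t, f t = P.[t].

Section PolyFun.
Variable F : comNzRingType.
Implicit Types f g : F -> F.

Lemma poly_fun_const (c : F) : poly_fun (fun=> c).
Proof. by exists c%:P => t; rewrite hornerC. Qed.

Lemma poly_funM f g : poly_fun f -> poly_fun g -> poly_fun (fun t => f t * g t).
Proof. by move=> [P hP] [Q hQ]; exists (P * Q) => t; rewrite hP hQ hornerM. Qed.

Lemma poly_fun_det k (A : F -> 'M[F]_k) :
  (forall i j, poly_fun (fun t => A t i j)) -> poly_fun (fun t => \det (A t)).
Proof.
move=> HA; rewrite /determinant.
have sumP (I : Type) (r : seq I) (f : I -> F -> F) :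
    (forall i, poly_fun (f i)) -> poly_fun (fun t => \sum_(i <- r) f i t).
  move=> hf; elim: r => [|i r [P hP]].
    by exists 0 => t; rewrite big_nil horner0.
  have [Q hQ] := hf i; exists (Q + P) => t.
  by rewrite big_cons hornerD hP hQ.
have prodP (I : Type) (r : seq I) (f : I -> F -> F) :
    (forall i, poly_fun (f i)) -> poly_fun (fun t => \prod_(i <- r) f i t).
  move=> hf; elim: r => [|i r [P hP]].
    by exists 1 => t; rewrite big_nil hornerC.
  have [Q hQ] := hf i; exists (Q * P) => t.
  by rewrite big_cons hornerM hP hQ.
apply: sumP => s; apply: poly_funM; first exact: poly_fun_const.
exact: prodP.
Qed.

End PolyFun.

(** Continuity at 0, in the elementary form needed here: if f t = t g t + c with
    c < 0 and |g| <= C on [0, 1], then f is negative at t = - c / (C + 1 - c). *)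
Lemma poly_fun_ge0 (R : realFieldType) (f : R -> R) : poly_fun f ->
  (forall t, 0 < t -> 0 <= f t) -> 0 <= f 0.
Proof.
have bound (P : {poly R}) : exists2 C, 0 <= C & forall t, 0 <= t <= 1 -> `|P.[t]| <= C.
  elim/poly_ind: P => [|P c [C C0 hC]].
    by exists 0 => // t _; rewrite horner0 normr0.
  exists (C + `|c|) => [|t /andP [t0 t1]]; first by rewrite addr_ge0.
  rewrite hornerMXaddC (le_trans (ler_normD _ _)) // lerD2r normrM (ger0_norm t0).
  by rewrite (le_trans (ler_piMr _ t1)) // hC // t0.
move=> [P hP] fge0; rewrite leNgt; apply/negP => f0.
have [Q [c hQ]] : exists Q c, P = Q * 'X + c%:P.
  by elim/poly_ind: P {hP} => [|Q c _]; [exists 0, 0; rewrite mul0r addr0|exists Q, c].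
have fE t : f t = Q.[t] * t + c by rewrite hP hQ hornerMXaddC.
have c0 : c < 0 by move: f0; rewrite fE mulr0 add0r.
have [C C0 hC] := bound Q.
pose t := - c / (C + 1 - c).
have d0 : 0 < C + 1 - c by lra.
have t0 : 0 < t by rewrite divr_gt0 // oppr_gt0.
have t1 : t <= 1 by rewrite ler_pdivrMr //; lra.
have := fge0 t t0; rewrite fE.
have Qt : Q.[t] <= C by rewrite (le_trans (ler_norm _)) // hC // t1 ltW.
have : Q.[t] * t <= C * t by rewrite ler_wpM2r // ltW.
have td : t * (C + 1 - c) = - c by rewrite divfK // gt_eqF.
by nra.
Qed.

Lemma poly_fun_ext (F : comNzRingType) (f g : F -> F) :
  f =1 g -> poly_fun g -> poly_fun f.
Proof. by move=> fg [P hP]; exists P => t; rewrite fg. Qed.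

Lemma poly_fun_nat_col (F : comNzRingType) k n (M : F -> 'M[F]_(k, n)) j a :
  (forall b i, poly_fun (fun t => M t b i)) -> poly_fun (fun t => nat_col (M t) j a 0).
Proof.
move=> HM; rewrite /nat_col; case: insub => [i|].
  by apply: poly_fun_ext (HM a i) => t; rewrite mxE.
by apply: poly_fun_ext (poly_fun_const 0) => t; rewrite mxE.
Qed.

Lemma poly_fun_minor (F : comNzRingType) k n (M : F -> 'M[F]_(k, n)) s :
  (forall a i, poly_fun (fun t => M t a i)) -> poly_fun (fun t => minor (M t) s).
Proof.
move=> HM; apply: poly_fun_det => a j.
have [js|sj] := ltnP j (size s).
  by apply: poly_fun_ext (poly_fun_nat_col (nth 0%N s j) a HM) => t; rewrite mxE (nth_map 0%N).
by apply: poly_fun_ext (poly_fun_const 0) => t; rewrite mxE nth_default ?mxE ?size_map.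
Qed.

Lemma poly_fun_twist (F : fieldType) k n (M : F -> 'M[F]_(k, n)) a i :
  (forall a i, poly_fun (fun t => M t a i)) -> poly_fun (fun t => twist (M t) a i).
Proof.
move=> HM; pose B t := append_col
  (fun j : 'I_k.-1 => col (iter (k - 1 - j) (@ord_pred n) i) (M t)) (delta_mx a 0).
apply: (@poly_fun_ext _ _ (fun t => twist_sign F k i.+1 * \det (B t))).
  by move=> t; rewrite !mxE.
apply: poly_funM; first exact: poly_fun_const.
apply: poly_fun_det => b j; rewrite /B /append_col.
case E: (insub (val j) : option 'I_k.-1) => [j'|].
  by apply: poly_fun_ext (HM b (iter (k - 1 - j') (@ord_pred n) i)) => t; rewrite mxE E mxE.
by apply: poly_fun_ext (poly_fun_const (delta_mx a (0 : 'I_1) b 0)) => t; rewrite mxE E.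
Qed.

(** * Column shears and moves of column sets *)

Definition col_shear (F : comNzRingType) k n (p : 'M[F]_(k, n)) (x y : 'I_n) (t : F) :
    'M[F]_(k, n) :=
  \matrix_(a, i) (p a i + (if i == x then t * p a y else 0)).

Definition adjacent (x y : nat) := (x == y.+1) || (y == x.+1).

(** There is no integer strictly between x and y, so replacing x by y keeps the
    order as soon as y is absent. *)
Lemma colset_replace k n s1 s2 x y : adjacent x y -> (y < n)%N -> y \notin s1 ++ s2 ->
  colset k n (s1 ++ x :: s2) -> colset k n (s1 ++ y :: s2).
Proof.
move=> xy yn; rewrite mem_cat negb_or => /andP [y1 y2].
rewrite /colset !size_cat /= !sorted_ltn_cat !sorted_ltn_cons !allrel_consr !all_cat /=.
move=> /and3P [/and3P [/andP [h1 h2] h3 /andP [h4 h5]] -> /and3P [h6 h7 h8]].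
rewrite h2 h3 h5 h6 h8 yn !andbT /=; apply/andP; split; apply/allP => z zs.
  have := allP h1 z zs; have : z != y by apply: contraNneq y1 => <-.
  by move: xy; rewrite /adjacent /=; clear; lia.
have := allP h4 z zs; have : z != y by apply: contraNneq y2 => <-.
by move: xy; rewrite /adjacent /=; clear; lia.
Qed.

Section Shear.
Variables (R : realDomainType) (m n : nat) (p : 'M[R]_(m.+1, n)) (x y : 'I_n).
Hypothesis xy : adjacent x y.
Implicit Types (s : seq nat).

Let sheared t s := minor (col_shear p x y t) s.

Lemma nat_col_shear t i : nat_col (col_shear p x y t) i =
  if i == x then nat_col p x + t *: nat_col p y else nat_col p i.
Proof.
rewrite !nat_colE /nat_col; case: insubP => [j _ <-|].
  apply/matrixP => a b; rewrite !mxE -[_ == _ :> nat]/(j == x).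
  by case: eqP => [->|]; rewrite !mxE ?addr0.
by case: eqP => // ->; rewrite ltn_ord.
Qed.

Lemma shear_fixed t s : nat_of_ord x \notin s -> sheared t s = minor p s.
Proof.
move=> xs; congr coldet; apply/eq_in_map => i si; rewrite nat_col_shear.
by case: eqP => // e; rewrite -e si in xs.
Qed.

Lemma shear_moved t s1 s2 : colset m.+1 n (s1 ++ (x : nat) :: s2) ->
  sheared t (s1 ++ (x : nat) :: s2) =
  minor p (s1 ++ (x : nat) :: s2) + t * minor p (s1 ++ (y : nat) :: s2).
Proof.
move=> /and3P [ss /eqP sz _].
have : uniq (s1 ++ (x : nat) :: s2) by apply: (sorted_uniq ltn_trans ltnn).
rewrite cat_uniq /= => /and4P [_ /norP [/= x1 _] x2 _].
rewrite /sheared /minor !map_cat /=.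
have e s : nat_of_ord x \notin s ->
   [seq nat_col (col_shear p x y t) i | i <- s] = [seq nat_col p i | i <- s].
  move=> xs; apply/eq_in_map => i si; rewrite nat_col_shear.
  by case: eqP => // e; rewrite -e si in xs.
rewrite !e // nat_col_shear eqxx coldet_insertD ?size_map //.
by move: sz; rewrite size_cat /=; lia.
Qed.

Lemma minor_repeat s1 s2 (z : nat) : size (s1 ++ z :: s2) = m.+1 -> z \in s1 ++ s2 ->
  minor p (s1 ++ z :: s2) = 0.
Proof.
move=> sz zs; move: sz; rewrite !size_cat /= => sz.
rewrite /minor map_cat coldet_repeat ?size_cat ?size_map //; try by lia.
by rewrite -map_cat map_f.
Qed.

Hypothesis p_ge0 : forall s, colset m.+1 n s -> 0 <= minor p s.

(** The minor changes by t times the minor with x replaced by y, which either has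
    a repeated column or is one of the nonnegative minors. *)
Lemma shear_le t s : 0 <= t -> colset m.+1 n s -> minor p s <= sheared t s.
Proof.
move=> t0 hs; have [xs|xs] := boolP (nat_of_ord x \in s); last by rewrite shear_fixed.
case: (path.splitPr xs) hs => s1 s2 hs.
rewrite shear_moved // lerDl mulr_ge0 //.
have [ys|ys] := boolP (nat_of_ord y \in s1 ++ s2).
  rewrite minor_repeat //.
  by case/and3P: hs => _ /eqP; rewrite !size_cat.
by apply: p_ge0; apply: colset_replace hs.
Qed.

End Shear.

(** At the first gap before an element, that element can be lowered. *)
Lemma colset_descent k n s : colset k n s -> s <> iota 0 k ->
  exists s1 x s2, s = s1 ++ x.+1 :: s2 /\ colset k n (s1 ++ x :: s2).
Proof.
move=> /and3P [ss /eqP <- sn] ne.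
have gap lo : all (leq lo) s -> s <> iota lo (size s) ->
   exists s1 x s2, [/\ s = s1 ++ x.+1 :: s2, all (fun z => z < x)%N s1 & (lo <= x)%N].
  elim: s lo ss {sn ne} => // z s IH lo; rewrite sorted_ltn_cons => /andP [zs ss].
  rewrite /= => /andP [loz _] ne.
  have [e|zlo] := eqVneq z lo; last first.
    by exists [::], z.-1, s; split => //=; [rewrite prednK //|]; lia.
  have [|e1|s1 [x [s2 [e1 h1 h2]]]] := IH lo.+1 ss; first by rewrite -e.
    by case: ne; rewrite {1}e e1 size_iota.
  by exists (z :: s1), x, s2; rewrite e1 /= h1 e h2; split => //; lia.
have [||s1 [x [s2 [e h _]]]] := gap 0%N; [by apply/allP|exact: ne|].
exists s1, x, s2; split => //; move: ss sn; rewrite e.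
rewrite /colset !size_cat /= !sorted_ltn_cat !sorted_ltn_cons !allrel_consr !all_cat /= h.
move=> /and3P [/andP [h1 h2] h3 /andP [h4 h5]] /and3P [h6 h7 h8].
rewrite h2 h3 h5 h6 h8 eqxx (ltnW h7) !andbT /=.
by apply: sub_all h4 => z /=; lia.
Qed.

(** Every column set descends to [0, k) by lowering one index at a time, and the
    moves are reversible. *)
Lemma colset_connected k n (S : pred (seq nat)) :
  (forall s1 s2 x y, adjacent x y -> colset k n (s1 ++ x :: s2) ->
     colset k n (s1 ++ y :: s2) -> S (s1 ++ y :: s2) -> S (s1 ++ x :: s2)) ->
  (exists2 s, colset k n s & S s) -> forall s, colset k n s -> S s.
Proof.
move=> step [s0 hs0 S0].
have base s : colset k n s -> S s = S (iota 0 k).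
  have [d] := ubnP (sumn s); elim: d s => // d IH s sd hs.
  have [->//|/eqP ne] := eqVneq s (iota 0 k).
  have [s1 [x [s2 [e hx]]]] := colset_descent hs ne.
  rewrite -(IH (s1 ++ x :: s2)) //; last first.
    by move: sd; rewrite e !sumn_cat /=; lia.
  rewrite e in hs *; apply/idP/idP; apply: step => //; rewrite /adjacent eqxx ?orbT //.
by move=> s hs; rewrite base // -(base s0).
Qed.

(** * The twist preserves nonnegativity of minors *)

Lemma poly_fun_shear (F : comNzRingType) k n (p : 'M[F]_(k, n)) x y a i :
  poly_fun (fun t => col_shear p x y t a i).
Proof.
exists ((p a i)%:P + (if i == x then p a y else 0) *: 'X) => t.
by rewrite mxE !hornerE; case: ifP => _; rewrite ?mul0r // mulrC.
Qed.

(** Induction on the number of column sets whose minor is not positive.  Arguing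
    by contradiction makes the closure of the positive column sets under moves
    available: at a move where it failed, the shear and the limit t -> 0 would
    give the desired inequality. *)
Lemma twist_minors_ge0 (R : realFieldType) m n (p : 'M[R]_(m.+1, n)) :
  (m < n)%N ->
  (forall s, colset m.+1 n s -> 0 <= minor p s) ->
  (exists2 s, colset m.+1 n s & 0 < minor p s) ->
  (forall s, colset m.+1 n s -> 0 <= minor (twist p) s).
Proof.
move=> mn.
pose zeros (p : 'M[R]_(m.+1, n)) :=
  [set I : {set 'I_n} | (#|I| == m.+1) && ~~ (0 < minor p (enum_ord I))].
have [d] := ubnP #|zeros p|; elim: d p => // d IH p pd p_ge0 p_pos s hs.
rewrite leNgt; apply/negP => tw_lt0.
suff p_gt0 : forall s, colset m.+1 n s -> 0 < minor p s.
  by have := twist_minors_gt0 mn p_gt0 hs; rewrite ltNge ltW.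
apply: (@colset_connected _ _ (fun s => 0 < minor p s) _ p_pos).
move=> s1 s2 x y xy hx hy py; apply: contraLR tw_lt0 => px; rewrite -leNgt.
have xn : (x < n)%N by case/and3P: hx => _ _; rewrite all_cat => /and3P [].
have yn : (y < n)%N by case/and3P: hy => _ _; rewrite all_cat => /and3P [].
pose q t := col_shear p (Ordinal xn) (Ordinal yn) t.
have pq t s' : 0 <= t -> colset m.+1 n s' -> minor p s' <= minor (q t) s'.
  exact: shear_le.
have q0 : q 0 = p.
  by apply/matrixP => a i; rewrite mxE mul0r if_same addr0.
rewrite -q0; apply: (@poly_fun_ge0 _ (fun t => minor (twist (q t)) s)) => [|t t0].
  apply: poly_fun_minor => a i.
  by apply: poly_fun_twist => b j; apply: poly_fun_shear.
apply: IH => //.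
- rewrite ltnS in pd; apply: leq_trans pd; rewrite proper_card //; apply/properP; split.
    apply/subsetP => I; rewrite !inE => /andP [cI] qI; rewrite cI /=.
    apply: contra qI => pI; rewrite (lt_le_trans pI) // pq // ?ltW //.
    by rewrite -(eqP cI) colset_enum_ord.
  have [I [cI eI]] := colset_set hx; exists I; rewrite inE cI eqxx -eI ?px //=.
  rewrite negbK /q shear_moved //.
  by rewrite ltr_wpDl ?p_ge0 // mulr_gt0.
- by move=> s' hs'; rewrite (le_trans (p_ge0 s' hs')) // pq // ltW.
- by case: p_pos => s' hs' ps'; exists s' => //; rewrite (lt_le_trans ps') // pq // ltW.
Qed.

Theorem corollary9p5 (R : realType) (k n : nat) (hk : (1 <= k <= n - 1)%N)
    (p : 'M[R]_(k, n)) :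
  (gr_totally_positive p -> gr_totally_positive (twist p)) /\
  (gr_totally_nonnegative p -> twist_defined p ->
     gr_totally_nonnegative (twist p)).
Proof.
case: k hk p => // m hk p; have mn : (m < n)%N by lia.
have rank_eq (p1 p2 : 'M[R]_(m.+1, n)) : gr_eq p1 p2 -> \rank p1 = \rank p2.
  by move=> [g gU ->]; rewrite (eqmxMfull p1) // row_full_unit.
split=> [[rp [q pq /plucker_minors q_gt0]]|[rp [q pq /plucker_minors q_ge0]] tw].
  have tq_gt0 := twist_minors_gt0 mn q_gt0.
  have tpq : gr_eq (twist p) (twist q) by exact: twist_gr_eq.
  split; last by exists (twist q) => //; apply/plucker_minors.
  have i0 : colset m.+1 n (iota 0 m.+1).
    apply/and3P; split; rewrite ?iota_ltn_sorted ?size_iota //.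
    by apply/allP => x; rewrite mem_iota /=; lia.
  by rewrite /gr_rep (rank_eq _ _ tpq) (minor_neq0_rank i0) // gt_eqF ?tq_gt0.
split=> //; exists (twist q); first exact: twist_gr_eq.
apply/plucker_minors/twist_minors_ge0 => //.
have [|s hs ps] := @rank_minor_neq0 _ _ _ q; first by rewrite -(rank_eq _ _ pq).
by exists s => //; rewrite lt0r ps q_ge0.
Qed.
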